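(* Let $n\geqslant 4$ and let $\langle a_0,b_0,e_0\mid R\rangle$ be a presentation of the monoid $\mathscr{T}^0_{n-1}$ on the generators $a_0$, $b_0$ and $e_0$. Then $$ \langle a_0,b_0,e_0,z \mid R,\ a_0z = b_0z = e_0z = z,\ z^2=(e_0b_0)^{n-3}e_0 \rangle $$ is a presentation of $\mathrm{End}\,S_n$ on the generators $a_0$, $b_0$, $e_0$ and $z$.
   Context: For an integer $n\geqslant 1$, let $\Omega_{n-1}=\{1,\ldots,n-1\}$ and $\Omega_{n-1}^0=\{0,1,\ldots,n-1\}$, and let $S_n$ be the star graph with vertex set $\Omega_{n-1}^0$ and edge set $\{\{0,i\}\mid 1\leqslant i\leqslant n-1\}$. Maps are written on the right of their arguments and composed from left to right (so $x(\alpha\beta)=(x\alpha)\beta$). $\mathrm{End}\,S_n$ is the monoid under composition of all endomorphisms of $S_n$, i.e. of all maps $\alpha:\Omega_{n-1}^0\to\Omega_{n-1}^0$ such that, for all vertices $u,v$, if $\{u,v\}$ is an edge of $S_n$ then $\{u\alpha,v\alpha\}$ is an edge of $S_n$. $\mathscr{T}^0_{n-1}$ is the monoid of all full transformations $\alpha$ of $\Omega_{n-1}^0$ such that $0\alpha=0$ and $\Omega_{n-1}\alpha\subseteq\Omega_{n-1}$. It is generated by $a_0,b_0,e_0$. The following are full transformations of $\Omega_{n-1}^0$: - $a_0$: $0\mapsto 0$, $1\mapsto 2$, $2\mapsto 1$, and $i\mapsto i$ for $3\leqslant i\leqslant n-1$; - $b_0$: $0\mapsto 0$, $i\mapsto i+1$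 for $1\leqslant i\leqslant n-2$, and $n-1\mapsto 1$; - $e_0$: $0\mapsto 0$, $1\mapsto 1$, $2\mapsto 1$, and $i\mapsto i$ for $3\leqslant i\leqslant n-1$; - $z$: $0\mapsto 1$ and $i\mapsto 0$ for $1\leqslant i\leqslant n-1$. Presentations: for an alphabet $X$, $X^*$ is the free monoid on $X$; a monoid presentation is a pair $\langle X\mid R\rangle$ with $R\subseteq X^*\times X^*$, and a pair $(u,v)\in R$ is written as a relation $u=v$ (a chain $u_1=u_2=\cdots=u_k$ abbreviates the corresponding relations between its terms). Let $\sim_R$ be the congruence on $X^*$ generated by $R$. If $X$ is a subset of a monoid $M$ generating $M$, then $\langle X\mid R\rangle$ is a presentation of $M$ on the generators $X$ if, for all $w_1,w_2\in X^*$, $w_1\sim_R w_2$ if and only if $w_1$ and $w_2$ represent the same element of $M$ (equivalently, the canonical homomorphism $X^*\to M$ induces an isomorphism $X^*/{\sim_R}\cong M$). The same symbols are used for the letters and for the elements of $M$ they represent. *)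

(* Defs.v *)
From HB Require Import structures.
From mathcomp Require Import all_boot.

Set Implicit Arguments.
Unset Strict Implicit.
Unset Printing Implicit Defensive.

(* The free monoid on X is seq X, with product ++ and unit [::]. *)

Inductive gen_congruence (X : Type) (R : seq X -> seq X -> Prop) :
    seq X -> seq X -> Prop :=
| gen_congruence_base u v : R u v -> gen_congruence R u v
| gen_congruence_refl u : gen_congruence R u u
| gen_congruence_sym u v : gen_congruence R u v -> gen_congruence R v u
| gen_congruence_trans u v w :
    gen_congruence R u v -> gen_congruence R v w -> gen_congruence R u w
| gen_congruence_cat u1 v1 u2 v2 :
    gen_congruence R u1 v1 -> gen_congruence R u2 v2 ->
    gen_congruence R (u1 ++ u2) (v1 ++ v2).

Definition word_eval (M : monoidType) (X : Type) (g : X -> M) (w : seq X) : M :=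
  (\prod_(x <- w) g x)%g.

(* The monoid being presented is a submonoid S of an ambient monoid M, and the
   alphabet X is identified with a subset of M by the injective map g; the second
   clause says that this subset lies in S and generates it. *)
Definition is_presentation (M : monoidType) (S : umagmaClosed M) (X : Type)
    (g : X -> M) (R : seq X -> seq X -> Prop) : Prop :=
  [/\ injective g,
      forall x : M, x \in S <-> exists w : seq X, word_eval g w = x
    & forall w1 w2 : seq X,
        gen_congruence R w1 w2 <-> word_eval g w1 = word_eval g w2].

(* Full transformations of {0, ..., n-1}, composed from left to right.  This is
   an alias because {ffun aT -> rT} itself carries the pointwise product whenever
   rT is a monoid. *)
Definition transf (n : nat) : Type := {ffun 'I_n -> 'I_n}.

HB.instance Definition _ n := Finite.on (transf n).

Section TransfMonoid.
Variable n : nat.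
Implicit Types f g h : transf n.

Definition transf_mul f g : transf n := [ffun i => g (f i)].
Definition transf_one : transf n := [ffun i => i].

Fact transf_mulA : associative transf_mul.
Proof. by move=> f g h; apply/ffunP=> i; rewrite !ffunE. Qed.

Fact transf_mul1 : left_id transf_one transf_mul.
Proof. by move=> f; apply/ffunP=> i; rewrite !ffunE. Qed.

Fact transf_1mul : right_id transf_one transf_mul.
Proof. by move=> f; apply/ffunP=> i; rewrite !ffunE. Qed.

HB.instance Definition _ :=
  isMonoid.Build (transf n) transf_mulA transf_mul1 transf_1mul.

End TransfMonoid.

Definition star_edges (n : nat) : {set {set 'I_n}} :=
  [set [set u; v] | u in [pred i : 'I_n | i == 0 :> nat],
                    v in [pred j : 'I_n | 0 < j]].

(* End S_n, with vertex set 'I_n. *)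
Definition EndS (n : nat) : {pred transf n} :=
  [pred f : transf n | [forall u, forall v,
     ([set u; v] \in star_edges n) ==> ([set f u; f v] \in star_edges n)]].

Arguments EndS : clear implicits.

Fact EndS_monoid_closed n : monoid_closed (EndS n).
Proof.
split=> [|f g /forallP Hf /forallP Hg].
  by apply/forallP=> u; apply/forallP=> v; rewrite !ffunE; apply/implyP.
apply/forallP=> u; apply/forallP=> v; rewrite !ffunE; apply/implyP=> uv.
have /forallP/(_ v)/implyP/(_ uv) fuv := Hf u.
by have /forallP/(_ (f v))/implyP/(_ fuv) := Hg (f u).
Qed.

HB.instance Definition _ n :=
  isMulClosed.Build (transf n) (EndS n) (EndS_monoid_closed n).2.
HB.instance Definition _ n :=
  isMul1Closed.Build (transf n) (EndS n) (EndS_monoid_closed n).1.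

(* The monoid written T^0_{n-1}: the index n here is the number of points. *)
Definition T0 (n : nat) : {pred transf n} :=
  [pred f : transf n | [forall i : 'I_n, (i == 0 :> nat) ==> (f i == 0 :> nat)]
                     && [forall i : 'I_n, (0 < i) ==> (0 < f i)]].

Arguments T0 : clear implicits.

Fact T0_monoid_closed n : monoid_closed (T0 n).
Proof.
split=> [|f g /andP[/forallP f0 /forallP fS] /andP[/forallP g0 /forallP gS]].
  by apply/andP; split; apply/forallP=> i; rewrite !ffunE; apply/implyP.
apply/andP; split; apply/forallP=> i; rewrite !ffunE; apply/implyP=> Hi.
- exact: (implyP (g0 _)) (implyP (f0 _) Hi).
- exact: (implyP (gS _)) (implyP (fS _) Hi).
Qed.

HB.instance Definition _ n :=
  isMulClosed.Build (transf n) (T0 n) (T0_monoid_closed n).2.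
HB.instance Definition _ n :=
  isMul1Closed.Build (transf n) (T0 n) (T0_monoid_closed n).1.

(* The transformation i |-> F i.  The default value i of insubd is used only
   where F i >= n, which never happens below when n >= 3. *)
Definition transf_of (n : nat) (F : nat -> nat) : transf n :=
  [ffun i : 'I_n => insubd i (F i)].

Definition a0 n := transf_of n [eta id with 1 |-> 2, 2 |-> 1].
Definition b0 n := transf_of n [eta succn with 0 |-> 0, n.-1 |-> 1].
Definition e0 n := transf_of n [eta id with 2 |-> 1].
Definition z  n := transf_of n (fun i => if i == 0 then 1 else 0).

Inductive letter : Type := A | B | E.

Definition gen_T0 (n : nat) (x : letter) : transf n :=
  match x with A => a0 n | B => b0 n | E => e0 n end.

(* Over the alphabet option letter, None is the letter z. *)
Definition gen_EndS (n : nat) (x : option letter) : transf n :=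
  if x is Some y then gen_T0 n y else z n.

Inductive EndS_rel (n : nat) (R : seq letter -> seq letter -> Prop) :
    seq (option letter) -> seq (option letter) -> Prop :=
| EndS_rel_R u v : R u v -> EndS_rel n R (map Some u) (map Some v)
| EndS_rel_az_bz : EndS_rel n R [:: Some A; None] [:: Some B; None]
| EndS_rel_bz_ez : EndS_rel n R [:: Some B; None] [:: Some E; None]
| EndS_rel_ez_z : EndS_rel n R [:: Some E; None] [:: None]
| EndS_rel_zz : EndS_rel n R [:: None; None]
    (flatten (nseq (n - 3) [:: Some E; Some B]) ++ [:: Some E]).

(* Main.v *)
(** An endomorphism of the star either fixes the centre and preserves the leaves, or
    sends every leaf to the centre and the centre to a leaf; the latter are the
    products [z * t] with [t] fixing the centre and preserving the leaves.  Since
    [u z ~ z] for every word [u] without [z], and [z z ~ c] where [c] is the word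
    [(e b)^(n-3) e], every word reduces to [u] or [z u] with [u] free of [z].  Two
    words [z u] and [z v] have the same value only if [c u] and [c v] do, since [c]
    sends every leaf to 1; then [z u ~ z z z u ~ z c u ~ z c v ~ z v]. *)
Require Import Defs.
From HB Require Import structures.
From mathcomp Require Import all_boot zify.

(** * Congruences on words and evaluation of words *)

Section FreeMonoid.
Variables (X : Type) (R : seq X -> seq X -> Prop).

Lemma gen_congruence_catl u v w :
  gen_congruence R v w -> gen_congruence R (u ++ v) (u ++ w).
Proof. by apply: gen_congruence_cat; apply: gen_congruence_refl. Qed.

Lemma gen_congruence_catr u v w :
  gen_congruence R u v -> gen_congruence R (u ++ w) (v ++ w).
Proof. by move=> uv; apply: gen_congruence_cat uv (gen_congruence_refl _ _). Qed.

Lemma gen_congruence_map (Y : Type) (f : X -> Y) (Q : seq Y -> seq Y -> Prop) :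
  (forall u v, R u v -> Q (map f u) (map f v)) ->
  forall u v, gen_congruence R u v -> gen_congruence Q (map f u) (map f v).
Proof.
move=> RQ u v; elim=> {u v} [u v|u|u v _|u v w _ uv _|u1 v1 u2 v2 _ e1 _ e2].
- by move=> /RQ; apply: gen_congruence_base.
- exact: gen_congruence_refl.
- exact: gen_congruence_sym.
- exact: gen_congruence_trans uv.
- by rewrite !map_cat; apply: gen_congruence_cat.
Qed.

Variables (M : monoidType) (g : X -> M).

Lemma word_eval_cons x w : word_eval g (x :: w) = (g x * word_eval g w)%g.
Proof. exact: big_cons. Qed.

Lemma word_eval_seq1 x : word_eval g [:: x] = g x.
Proof. exact: big_seq1. Qed.

Lemma word_eval_cat u v :
  word_eval g (u ++ v) = (word_eval g u * word_eval g v)%g.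
Proof. exact: big_cat. Qed.

Lemma word_eval_gen_congruence :
  (forall u v, R u v -> word_eval g u = word_eval g v) ->
  forall u v, gen_congruence R u v -> word_eval g u = word_eval g v.
Proof.
move=> RM u v; elim=> {u v} [u v /RM|//|//|u v w _ -> _ -> //|] //.
by move=> u1 v1 u2 v2 _ e1 _ e2; rewrite !word_eval_cat e1 e2.
Qed.

Lemma presentation_gen_in (S : umagmaClosed M) :
  is_presentation S g R -> forall x, g x \in S.
Proof. by case=> _ S_gen _ x; apply/S_gen; exists [:: x]; apply: word_eval_seq1. Qed.

End FreeMonoid.

(** * The generators acting on the centre and the leaves *)

Section Star.
Variable n : nat.
Hypothesis n_gt3 : 3 < n.
Implicit Types (f g t : transf n) (i : 'I_n) (u v w : seq letter).

(** The centre, followed by the leaf 1, to which [z] sends the centre. *)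
Let o : 'I_n := Ordinal (ltn_trans (isT : 0 < 3) n_gt3).
Let l : 'I_n := Ordinal (ltn_trans (isT : 1 < 3) n_gt3).

Lemma transfM f g i : (f * g)%g i = g (f i).
Proof. exact: ffunE. Qed.

Lemma transf_ofE (F : nat -> nat) i : F i < n -> transf_of n F i = F i :> nat.
Proof. by move=> Fi; rewrite ffunE val_insubd Fi. Qed.

Lemma zE i : z n i = (if i == 0 :> nat then 1 else 0) :> nat.
Proof. by rewrite transf_ofE //; case: ifP => _; lia. Qed.

Lemma z_center : z n o = l.
Proof. by apply: ord_inj; rewrite zE. Qed.

Lemma z_leaf i : 0 < i -> z n i = o.
Proof. by move=> i_gt0; apply: ord_inj; rewrite zE; case: eqP => //; lia. Qed.

(** One round of shifting and merging: 1 goes to 2 and back to 1, and [n.-1] wraps around to 1, so a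
    leaf that has reached 1 stays there. *)
Lemma b0_e0E i :
  e0 n (b0 n i) = (if i == 0 :> nat then 0 else
                   if (i == 1 :> nat) || (i == n.-1 :> nat) then 1 else i.+1)
    :> nat.
Proof.
have lt_in := ltn_ord i.
have b0E : b0 n i = (if i == 0 :> nat then 0 else
                     if i == n.-1 :> nat then 1 else i.+1) :> nat.
  by rewrite transf_ofE /=; do 2?case: eqP; lia.
rewrite transf_ofE /= b0E; do ?case: eqP => //=; lia.
Qed.

(** * The word that sends every leaf to 1 *)

Definition collapse k := flatten (nseq k [:: E; B]) ++ [:: E].

(** Regrouping (e b)^k e as e (b e)^k puts the new letters on the right, where they act last. *)
Lemma collapseS k : collapse k.+1 = collapse k ++ [:: B; E].
Proof.
rewrite /collapse; elim: k => //= k IHk.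
by rewrite IHk.
Qed.

(** The initial [E] merges 2 into 1; each later round moves a leaf above 2 up by one until it falls
    off the end and lands on 1. *)
Lemma collapseE k i :
  word_eval (gen_T0 n) (collapse k) i =
    (if i == 0 :> nat then 0 else
     if (2 < i) && (i + k < n) then i + k else 1) :> nat.
Proof.
have lt_in := ltn_ord i; elim: k => [|k IHk].
  rewrite /collapse /= word_eval_seq1 transf_ofE /=; do 3?case: ifP; lia.
rewrite collapseS word_eval_cat !transfM word_eval_cons word_eval_seq1 transfM.
by move: IHk; rewrite b0_e0E; do !case: ifP; lia.
Qed.

Lemma collapse_center : word_eval (gen_T0 n) (collapse (n - 3)) o = o.
Proof. by apply: ord_inj; rewrite collapseE. Qed.

(** A leaf above 2 needs [n - i] rounds to reach 1; the slowest is 3, whence [n - 3]. *)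
Lemma collapse_leaf i : 0 < i -> word_eval (gen_T0 n) (collapse (n - 3)) i = l.
Proof.
by move=> i_gt0; apply: ord_inj; rewrite collapseE /=; do 2?case: ifP; lia.
Qed.

Lemma eq_transf f g : f o = g o -> (forall i, 0 < i -> f i = g i) -> f = g.
Proof.
move=> fg0 fgS; apply/ffunP=> i; case: (posnP i) => [i0|/fgS //].
by have -> : i = o by apply: ord_inj.
Qed.

Lemma zz_collapse : (z n * z n)%g = word_eval (gen_T0 n) (collapse (n - 3)).
Proof.
apply: eq_transf => [|i i_gt0]; rewrite transfM.
  by rewrite z_center z_leaf // collapse_center.
by rewrite (z_leaf i) // z_center collapse_leaf.
Qed.

(** * Membership criteria and the two kinds of endomorphisms *)

Lemma T0P f :
  reflect (f o = o /\ forall i, 0 < i -> 0 < f i) (f \in T0 n).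
Proof.
apply: (iffP andP) => [[/forallP f0 /forallP fS]|[f0 fS]].
  split=> [|i]; last exact/implyP.
  by apply: ord_inj; apply/eqP/(implyP (f0 o)).
split; apply/forallP=> i; apply/implyP; last exact: fS.
by move=> i0; have -> : i = o; [apply: ord_inj; apply/eqP | rewrite f0].
Qed.

Lemma mem_star_edges (u v : 'I_n) :
  ([set u; v] \in star_edges n) = (u == 0 :> nat) (+) (v == 0 :> nat).
Proof.
apply/imset2P/idP => [[x y]|].
  rewrite !inE => x0 y0 uvE.
  (* Equality of the two pairs is used through four memberships, which suffice for [lia]. *)
  have := set21 u v; have := set22 u v; rewrite uvE !inE.
  have := set21 x y; have := set22 x y; rewrite -uvE !inE -!val_eqE /=; lia.
case: (posnP u) => [u0|u0]; case: (posnP v) => [v0|v0]; rewrite ?u0 ?v0; try lia.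
- by exists u v; rewrite ?inE ?u0.
- by exists v u; rewrite ?inE ?v0 // setUC.
Qed.

Lemma EndSP f :
  reflect (forall i, 0 < i -> (f o == 0 :> nat) (+) (f i == 0 :> nat))
          (f \in EndS n).
Proof.
apply: (iffP forallP) => [f_end i i_gt0|f_end u].
  have /forallP/(_ i)/implyP := f_end o.
  by rewrite !mem_star_edges; apply=> /=; lia.
have center i : i = 0 :> nat -> i = o by move=> i0; apply: ord_inj.
apply/forallP=> v; apply/implyP; rewrite !mem_star_edges.
case: (posnP u) => [/center->|u0]; case: (posnP v) => [/center->|v0] //=; try lia.
- by move=> _; apply: f_end.
- by move=> _; rewrite addbC; apply: f_end.
Qed.

Lemma T0_sub_EndS : {subset T0 n <= EndS n}.
Proof. by move=> f /T0P[f0 fS]; apply/EndSP=> i /fS; rewrite f0 /=; lia. Qed.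

Lemma z_EndS : z n \in EndS n.
Proof. by apply/EndSP=> i i_gt0; rewrite z_center z_leaf. Qed.

Lemma EndS_cases f :
  f \in EndS n -> f \in T0 n \/ exists2 t, t \in T0 n & f = (z n * t)%g.
Proof.
move=> /EndSP f_end; case: (posnP (f o)) => f0.
  left; apply/T0P; split; first exact: ord_inj.
  by move=> i /f_end; rewrite f0 /=; lia.
(* [z] takes only the values 0 and 1, so [t] matters only there; sending every leaf to [f o] keeps
   it in [T0 n]. *)
right; exists ([ffun i => if i == o then o else f o] : transf n).
  apply/T0P; split=> [|i i_gt0]; rewrite ffunE ?eqxx //.
  by case: eqP i_gt0 => [->|].
apply: eq_transf => [|i i_gt0]; rewrite transfM ?z_center ?z_leaf // ffunE //.
by apply: ord_inj; move/f_end: i_gt0 => /=; lia.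
Qed.

Lemma z_mul_eq f g : (z n * f = z n * g)%g -> f l = g l.
Proof. by move/ffunP/(_ o); rewrite !transfM z_center. Qed.

(** * Soundness and rewriting to normal form *)

Variable R : seq letter -> seq letter -> Prop.
Hypothesis hR : is_presentation (T0 n) (gen_T0 n) R.

Notation "u ~ v" := (gen_congruence (EndS_rel n R) u v) (at level 70).
Notation ev := (word_eval (gen_EndS n)).

Lemma word_eval_Some w : ev (map Some w) = word_eval (gen_T0 n) w.
Proof. exact: big_map. Qed.

Lemma word_eval_T0 w : word_eval (gen_T0 n) w \in T0 n.
Proof. by case: hR => _ T0_gen _; apply/T0_gen; exists w. Qed.

(** [z] only distinguishes the centre from the leaves, and elements of [T0 n] preserve that
    distinction. *)
Lemma T0_mul_z f : f \in T0 n -> (f * z n)%g = z n.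
Proof.
case/T0P=> f0 fS; apply: eq_transf => [|i i_gt0]; rewrite transfM ?f0 //.
by rewrite !z_leaf ?fS.
Qed.

Lemma map_collapse k :
  map Some (collapse k) = flatten (nseq k [:: Some E; Some B]) ++ [:: Some E].
Proof. by rewrite /collapse map_cat map_flatten map_nseq. Qed.

Lemma EndS_rel_sound (u v : seq (option letter)) : EndS_rel n R u v -> ev u = ev v.
Proof.
have letter_z x : ev [:: Some x; None] = z n.
  rewrite word_eval_cons word_eval_seq1 T0_mul_z //.
  exact: presentation_gen_in hR x.
case=> [{}u {}v Ruv||||]; rewrite ?letter_z //.
- rewrite !word_eval_Some; case: hR => _ _ R_ev.
  by apply/R_ev/gen_congruence_base.
- by rewrite word_eval_seq1.
- by rewrite -map_collapse word_eval_Some -zz_collapse word_eval_cons word_eval_seq1.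
Qed.

(** The presentation of [T0 n] supplies a derivation, which is carried over along [Some]. *)
Lemma congr_Some u v :
  word_eval (gen_T0 n) u = word_eval (gen_T0 n) v -> map Some u ~ map Some v.
Proof.
case: hR => _ _ R_ev /R_ev; apply: gen_congruence_map => {}u {}v.
exact: EndS_rel_R.
Qed.

Lemma congr_letter_z x : [:: Some x; None] ~ [:: None].
Proof.
have ez : [:: Some E; None] ~ [:: None].
  exact/gen_congruence_base/EndS_rel_ez_z.
have bz : [:: Some B; None] ~ [:: None].
  exact: gen_congruence_trans (gen_congruence_base (EndS_rel_bz_ez _ _)) ez.
case: x => //.
exact: gen_congruence_trans (gen_congruence_base (EndS_rel_az_bz _ _)) bz.
Qed.

Lemma congr_word_z w : map Some w ++ [:: None] ~ [:: None].
Proof.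
elim: w => [|x w IHw]; first exact: gen_congruence_refl.
apply: gen_congruence_trans (congr_letter_z x).
exact: (gen_congruence_catl _ _ [:: Some x] _ _ IHw).
Qed.

Lemma congr_zz : [:: None; None] ~ map Some (collapse (n - 3)).
Proof. by rewrite map_collapse; apply/gen_congruence_base/EndS_rel_zz. Qed.

(** The cube of z is read in two ways: z ~ c z ~ z z z ~ z c. *)
Lemma congr_z_collapse : [:: None] ~ None :: map Some (collapse (n - 3)).
Proof.
apply: gen_congruence_trans (gen_congruence_catl _ _ [:: None] _ _ congr_zz).
apply: gen_congruence_trans (gen_congruence_sym (congr_word_z (collapse (n - 3)))) _.
apply: (gen_congruence_catr _ _ _ [:: None; None] [:: None]).
exact: gen_congruence_sym congr_zz.
Qed.

(** Letters are added on the left: before a leading z, a letter other than z is absorbed, and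
    another z turns the pair into c. *)
Lemma congr_normal_form (w : seq (option letter)) :
  exists v, w ~ map Some v \/ w ~ None :: map Some v.
Proof.
elim: w => [|[x|] w [v [wv|wv]]].
- by exists [::]; left; apply: gen_congruence_refl.
- by exists (x :: v); left; apply: (gen_congruence_catl _ _ [:: Some x] _ _ wv).
- exists v; right.
  apply: gen_congruence_trans (gen_congruence_catl _ _ [:: Some x] _ _ wv) _.
  exact: (gen_congruence_catr _ _ _ _ (map Some v) (congr_letter_z x)).
- by exists v; right; apply: (gen_congruence_catl _ _ [:: None] _ _ wv).
- exists (collapse (n - 3) ++ v); left; rewrite map_cat.
  apply: gen_congruence_trans (gen_congruence_catl _ _ [:: None] _ _ wv) _.
  exact: (gen_congruence_catr _ _ _ _ (map Some v) congr_zz).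
Qed.

Lemma congr_z_word u v :
  ev (None :: map Some u) = ev (None :: map Some v) ->
  None :: map Some u ~ None :: map Some v.
Proof.
rewrite !word_eval_cons !word_eval_Some => /z_mul_eq uv_l.
have expand w : None :: map Some w ~ None :: map Some (collapse (n - 3) ++ w).
  rewrite map_cat.
  exact: (gen_congruence_catr _ _ _ _ (map Some w) congr_z_collapse).
apply: gen_congruence_trans (expand u) _.
apply: gen_congruence_trans (gen_congruence_sym (expand v)).
(* [u] and [v] may differ on leaves other than 1; the prefix c hides this, so only agreement at [l]
   and at the centre is needed. *)
apply/(gen_congruence_catl _ _ [:: None])/congr_Some.
rewrite (word_eval_cat _ _ _ _ u) (word_eval_cat _ _ _ _ v).
apply: eq_transf => [|i i_gt0]; rewrite !transfM.
  have /T0P[u0 _] := word_eval_T0 u; have /T0P[v0 _] := word_eval_T0 v.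
  by rewrite collapse_center u0 v0.
by rewrite collapse_leaf.
Qed.

(** * Separation of the normal forms, completeness and generation *)

Lemma z_mul_notin_T0 t : t \in T0 n -> (z n * t)%g \notin T0 n.
Proof.
case/T0P=> _ /(_ l isT) tl; apply/negP=> /T0P[].
by rewrite transfM z_center => tl0; rewrite tl0 in tl.
Qed.

Lemma word_eval_z_neq u v : ev (None :: map Some u) <> ev (map Some v).
Proof.
rewrite word_eval_cons !word_eval_Some => uv.
by have := z_mul_notin_T0 _ (word_eval_T0 u); rewrite uv word_eval_T0.
Qed.

Lemma congr_complete (w1 w2 : seq (option letter)) : ev w1 = ev w2 -> w1 ~ w2.
Proof.
have sound (u v : seq (option letter)) : u ~ v -> ev u = ev v.
  exact: (word_eval_gen_congruence _ _ _ _ EndS_rel_sound).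
have [u1 w1E] := congr_normal_form w1; have [u2 w2E] := congr_normal_form w2.
move=> w12; case: w1E => w1u; case: w2E => w2u;
  rewrite (sound _ _ w1u) (sound _ _ w2u) in w12;
  apply: gen_congruence_trans w1u (gen_congruence_trans _ (gen_congruence_sym w2u)).
- by apply: congr_Some; rewrite -!word_eval_Some.
(* Mixed normal forms never share a value: the one with z moves the centre, the other fixes it. *)
- by case: (word_eval_z_neq _ _ (esym w12)).
- by case: (word_eval_z_neq _ _ w12).
- exact: congr_z_word.
Qed.

Lemma z_notin_T0 : z n \notin T0 n.
Proof. by rewrite -[z n]mulg1 z_mul_notin_T0 ?gpred1. Qed.

(** The letters other than z are already distinct by [hR], and their values lie in [T0 n] while
    [z n] does not. *)
Lemma gen_EndS_inj : injective (gen_EndS n).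
Proof.
have neq x : gen_T0 n x <> z n.
  by move=> xz; have := z_notin_T0; rewrite -xz (presentation_gen_in _ _ _ _ _ hR).
case: hR => inj_gen _ _ [x|] [y|] //= => [/inj_gen->||] //.
- by move/neq.
- by move/esym/neq.
Qed.

Lemma EndS_generated f : f \in EndS n <-> exists w : seq (option letter), ev w = f.
Proof.
split=> [f_end|[w <-]].
  case: hR => _ T0_gen _; case: (EndS_cases _ f_end) => [|[t]] /T0_gen[w].
    by move <-; exists (map Some w); rewrite word_eval_Some.
  by move <- => ->; exists (None :: map Some w);
    rewrite word_eval_cons word_eval_Some.
elim: w => [|x w IHw]; first by rewrite /word_eval big_nil gpred1.
rewrite word_eval_cons gpredM //; case: x => [x|]; last exact: z_EndS.
exact/T0_sub_EndS/(presentation_gen_in _ _ _ _ _ hR).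
Qed.

End Star.

Theorem theorem3p1 (n : nat) (hn : 4 <= n)
    (R : seq letter -> seq letter -> Prop)
    (hR : is_presentation (T0 n) (gen_T0 n) R) :
  is_presentation (EndS n) (gen_EndS n) (EndS_rel n R).
Proof.
split=> [|f|w1 w2]; first exact: gen_EndS_inj hn _ hR.
  exact: EndS_generated hn _ hR f.
split; last exact: congr_complete hn _ hR w1 w2.
exact: word_eval_gen_congruence (EndS_rel_sound n hn _ hR) w1 w2.
Qed.
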